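(* For $n\ge 1$ and $k\ge 3$, $$|\mathfrak{S}_n(132,\mathrm{A}_k)|=C_n-C_{n-1}+|\mathfrak{S}_{n-1}(132,12\cdots(k-1))|.$$
   Context: $C_n=\frac{1}{n+1}\binom{2n}{n}$ is the $n$-th Catalan number. $\mathfrak{S}_n$ is the set of permutations $\sigma=\sigma_1\sigma_2\cdots\sigma_n$ of $[n]=\{1,\dots,n\}$ in one-line notation ($\mathfrak{S}_0$ consists of the empty permutation only, which avoids every nonempty pattern). A mesh pattern is a pair $p=(\pi,R)$ with $\pi\in\mathfrak{S}_m$ and $R\subseteq\{0,\dots,m\}\times\{0,\dots,m\}$ (the set of shaded unit cells, each given by its bottom-left corner, in the grid with dots at $(i,\pi_i)$). An occurrence of $p$ in $\sigma\in\mathfrak{S}_n$ is a choice of indices $i_1<\cdots<i_m$ such that $\sigma_{i_1}\cdots\sigma_{i_m}$ is order-isomorphic to $\pi$ and, for every $(a,b)\in R$, there is no index $r$ with $i_a<r<i_{a+1}$ and $v_b<\sigma_r<v_{b+1}$; here $v_1<\cdots<v_m$ is the increasing rearrangement of $\sigma_{i_1},\dots,\sigma_{i_m}$, $i_0=v_0=0$ and $i_{m+1}=v_{m+1}=n+1$. A classical pattern $\pi$ is the mesh pattern $(\pi,\varnothing)$. $\mathfrak{S}_n(p,q)$ is the set of permutations in $\mathfrak{S}_n$ with no occurrence of $p$ and no occurrence of $q$. Here $132$ and $12\cdots(k-1)$ are classical patterns and $\mathrm{A}_k=(12\cdots k,\{(0,k),(k,0)\})$. *)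

(* Defs.v *)
From mathcomp Require Import all_boot all_order all_algebra all_fingroup.

Set Implicit Arguments.
Unset Strict Implicit.
Unset Printing Implicit Defensive.

(* A permutation of [n] is s : 'S_n acting on 'I_n = {0, ..., n-1}: its
   one-line notation is (s i).+1 at position i.+1. The cells of the grid and
   the boundary conventions below use the 1-based positions and values. *)

Record mesh_pattern := MeshPattern {
  mesh_len : nat;
  mesh_perm : 'S_mesh_len;
  mesh_shade : {set 'I_mesh_len.+1 * 'I_mesh_len.+1} }.

Definition classical (m : nat) (pi : 'S_m) : mesh_pattern :=
  MeshPattern pi set0.

Section Occurrence.

Variables (m n : nat) (s : 'S_n) (f : {ffun 'I_m -> 'I_n}).

(* 0 = i_0, i_1, ..., i_m, i_(m+1) = n+1, where i_(j.+1) = (f j).+1 *)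
Definition occ_positions : seq nat :=
  0 :: rcons [seq (f j : nat).+1 | j <- enum 'I_m] n.+1.

(* 0 = v_0, v_1, ..., v_m, v_(m+1) = n+1 *)
Definition occ_values : seq nat :=
  0 :: rcons (sort leq [seq (s (f j) : nat).+1 | j <- enum 'I_m]) n.+1.

Definition cell_empty (a b : nat) : bool :=
  ~~ [exists r : 'I_n,
       (nth 0 occ_positions a < r.+1 < nth 0 occ_positions a.+1) &&
       (nth 0 occ_values b < (s r).+1 < nth 0 occ_values b.+1)].

End Occurrence.

Definition occurrence (p : mesh_pattern) (n : nat) (s : 'S_n)
    (f : {ffun 'I_(mesh_len p) -> 'I_n}) : bool :=
  [&& [forall i : 'I_(mesh_len p), forall j : 'I_(mesh_len p),
         (i < j) ==> (f i < f j)],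
      [forall i : 'I_(mesh_len p), forall j : 'I_(mesh_len p),
         (s (f i) < s (f j)) == (mesh_perm p i < mesh_perm p j)]
    & [forall c in mesh_shade p, cell_empty s f c.1 c.2]].

Definition contains (p : mesh_pattern) (n : nat) (s : 'S_n) : bool :=
  [exists f : {ffun 'I_(mesh_len p) -> 'I_n}, occurrence s f].

Definition avoiders (n : nat) (p q : mesh_pattern) : {set 'S_n} :=
  [set s : 'S_n | ~~ contains p s & ~~ contains q s].

(* The division is exact. *)
Definition catalan (n : nat) : nat := 'C(2 * n, n) %/ n.+1.

Definition increasing_perm (m : nat) : 'S_m := 1%g.

(* 132 exchanges the last two positions, i.e. 1 and 2 when counted from 0. *)
Definition perm132 : 'S_3 :=
  tperm (Ordinal (isT : 1 < 3)) (Ordinal (isT : 2 < 3)).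

Definition pattern132 : mesh_pattern := classical perm132.

Definition pattern_A (k : nat) : mesh_pattern :=
  @MeshPattern k (increasing_perm k) [set (ord0, ord_max); (ord_max, ord0)].

(* Main.v *)
Require Import Defs.
From mathcomp Require Import all_boot all_order all_algebra all_fingroup.
From mathcomp Require Import zify ring.

(** Let A_k be the increasing pattern of length k with its two shaded corners.
    In a 132-avoiding permutation s of [n], an occurrence of A_k forces s to
    end with its maximum. Indeed the maximum cannot stand to the left of the
    occurrence, as it would lie in the shaded top left cell. If it is not the
    last letter, let r be the last letter. The first point of the occurrence,
    the maximum and r must not form a 132, so r is at most that first point in
    value; then r lies in the shaded bottom right cell or belongs to the
    occurrence, and both are impossible. This is [contains_A_max_last].
    Conversely, when s ends with its maximum, that letter may serve as the last
    point of the pattern, and then nothing can lie in the shaded cells: s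
    contains A_k iff s without its last letter contains 12...(k-1)
    ([contains_A_lift_last]). Deleting the last letter is therefore a bijection
    from the 132-avoiders of size n that contain A_k to those of size n - 1 that
    contain 12...(k-1), and the theorem follows by taking complements, provided
    that the 132-avoiders of each size n are counted by the Catalan number.

    This last count ([card_avoids132]) comes from deleting the first letter.
    Put a first letter j before t, raising by one the values at least j: the
    result avoids 132 iff t does and its first letter is at most j
    ([avoids132_lift_first]). So the number of 132-avoiders with first letter at
    most j satisfies the recurrence of the ballot numbers, which are a difference
    of two consecutive binomial coefficients. *)

Set Implicit Arguments.
Unset Strict Implicit.
Unset Printing Implicit Defensive.

(** * Occurrences of the patterns *)

Lemma avoids132P n (s : 'S_n) :
  reflect (forall i j k : 'I_n, i < j -> j < k -> ~~ (s i < s k < s j))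
          (~~ contains pattern132 s).
Proof.
have pE (x : 'I_3) : perm132 x = nth 0 [:: 0; 2; 1] x :> nat.
  rewrite /perm132 permE /=.
  by case: x => [[|[|[|//]]] ltx]; rewrite -!val_eqE.
apply: (iffP idP) => [noocc i j k ltij ltjk | noocc].
  apply: contraNN noocc => /andP[ltik ltkj]; apply/existsP.
  exists [ffun x => tnth [tuple i; j; k] x]; apply/and3P; split.
  - apply/forallP=> -[[|[|[|//]]] ltx]; apply/forallP=> -[[|[|[|//]]] lty];
      rewrite !ffunE !(tnth_nth i) /=; lia.
  - apply/forallP=> -[[|[|[|//]]] ltx]; apply/forallP=> -[[|[|[|//]]] lty];
      rewrite !ffunE !(tnth_nth i) !pE /=; apply/eqP; lia.
  - by apply/forallP=> c; rewrite inE.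
apply/existsP=> -[f /and3P[/forallP posf /forallP valf _]].
pose o1 := Ordinal (isT : 1 < 3); pose o2 := Ordinal (isT : 2 < 3).
have := noocc (f ord0) (f o1) (f o2).
have /forallP/(_ o1)/implyP-> // := posf ord0.
have /forallP/(_ o2)/implyP-> // := posf o1.
have /forallP/(_ o2)/eqP-> := valf ord0.
have /forallP/(_ o1)/eqP-> := valf o2.
by rewrite !pE /= => /(_ isT isT).
Qed.

(** For the identity pattern, order isomorphism reduces to strict monotonicity
    because the order on values is total. *)
Lemma contains_increasingP m n (s : 'S_n) :
  reflect (exists f : 'I_m -> 'I_n,
             (forall i j : 'I_m, i < j -> f i < f j) /\
             (forall i j : 'I_m, i < j -> s (f i) < s (f j)))
          (contains (classical (increasing_perm m)) s).
Proof.
apply: (iffP existsP) => [[f /and3P[posf valf _]] | [f [posf valf]]].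
  exists f; split=> i j ltij.
    by have /forallP/(_ i)/forallP/(_ j)/implyP := posf; apply.
  by have /forallP/(_ i)/forallP/(_ j)/eqP-> := valf; rewrite !perm1.
exists (finfun f); apply/and3P; split.
- by apply/forallP=> i; apply/forallP=> j; apply/implyP; rewrite !ffunE; apply: posf.
- apply/forallP=> i; apply/forallP=> j; rewrite !ffunE !perm1; apply/eqP.
  case: (ltngtP i j) => [||/val_inj->]; [exact: valf| |exact: ltnn].
  by move=> /valf; lia.
- by apply/forallP=> c; rewrite inE.
Qed.

(** The shaded cells involve only the two end points of the occurrence, since
    its values increase with its positions. The inequalities on r may be weak
    because the letters of s are distinct. *)
Lemma contains_AP m n (s : 'S_n) :
  reflect (exists f : 'I_m.+1 -> 'I_n,
             [/\ forall i j : 'I_m.+1, i < j -> f i < f j,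
                 forall i j : 'I_m.+1, i < j -> s (f i) < s (f j),
                 forall r : 'I_n, r < f ord0 -> s r <= s (f ord_max) &
                 forall r : 'I_n, f ord_max < r -> s (f ord0) <= s r])
          (contains (pattern_A m.+1) s).
Proof.
have posE (f : {ffun 'I_m.+1 -> 'I_n}) (i : 'I_m.+1) :
    nth 0 (occ_positions f) i.+1 = (f i).+1.
  rewrite /= nth_rcons size_map size_enum_ord ltn_ord.
  by rewrite (nth_map ord0) ?size_enum_ord // nth_ord_enum.
have posN (f : {ffun 'I_m.+1 -> 'I_n}) : nth 0 (occ_positions f) m.+2 = n.+1.
  by rewrite /= nth_rcons size_map size_enum_ord ltnn eqxx.
have valE (f : {ffun 'I_m.+1 -> 'I_n}) :
    (forall i j : 'I_m.+1, i < j -> s (f i) < s (f j)) ->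
    (forall i : 'I_m.+1, nth 0 (occ_values s f) i.+1 = (s (f i)).+1)
    /\ nth 0 (occ_values s f) m.+2 = n.+1.
  move=> valf.
  (* The values are already sorted when taken in the order of the positions. *)
  have -> : occ_values s f
      = 0 :: rcons [seq (s (f j) : nat).+1 | j <- enum 'I_m.+1] n.+1.
    congr (_ :: rcons _ _); apply: sorted_sort; first exact: leq_trans.
    rewrite sorted_map; apply: (@sub_sorted _ (relpre val ltn)).
      by move=> i j /valf /= /ltnW.
    by rewrite -sorted_map val_enum_ord iota_ltn_sorted.
  split=> [i|] /=; rewrite nth_rcons size_map size_enum_ord ?ltnn ?eqxx //.
  by rewrite ltn_ord (nth_map ord0) ?size_enum_ord // nth_ord_enum.
apply: (iffP existsP) => [[/= f /and3P[posf valf /forallP /= meshf]] | ].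
  have valf' (i j : 'I_m.+1) : i < j -> s (f i) < s (f j).
    by have /forallP/(_ i)/forallP/(_ j)/eqP-> := valf; rewrite !perm1.
  have [vE vN] := valE f valf'.
  exists f; split=> // [i j ltij|r ltr|r ltr].
  - by have /forallP/(_ i)/forallP/(_ j)/implyP := posf; apply.
  - have := meshf (ord0, ord_max); rewrite !inE eqxx /= => /existsPn/(_ r).
    rewrite (posE f ord0) (vE ord_max) vN /= !ltnS.
    by have := ltn_ord (s r); lia.
  - have := meshf (ord_max, ord0); rewrite !inE eqxx orbT /= => /existsPn/(_ r).
    rewrite (posE f ord_max) (vE ord0) posN /= !ltnS.
    by have := ltn_ord r; lia.
move=> [f [posf valf nw se]].
have [vE vN] : _ /\ _ := valE (finfun f) ltac:(by move=> i j; rewrite !ffunE; apply: valf).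
exists (finfun f); apply/and3P; split.
- by apply/forallP=> i; apply/forallP=> j; apply/implyP; rewrite !ffunE; apply: posf.
- apply/forallP=> i; apply/forallP=> j; rewrite !ffunE !perm1; apply/eqP.
  case: (ltngtP i j) => [||/val_inj->]; [exact: valf| |exact: ltnn].
  by move=> /valf; lia.
apply/forallP=> c; apply/implyP; rewrite !inE => /orP[]/eqP->; apply/existsPn => r.
- rewrite (posE _ ord0) (vE ord_max) vN /= !ffunE !ltnS.
  by have := nw r; have := ltn_ord (s r); lia.
- rewrite (posE _ ord_max) (vE ord0) posN /= !ffunE !ltnS.
  by have := se r; have := ltn_ord r; lia.
Qed.

(** * Deleting a letter *)

Lemma ltn_lift n (h : 'I_n.+1) (i j : 'I_n) : (lift h i < lift h j) = (i < j).
Proof. rewrite /lift /= /bump; case: (leqP h i); case: (leqP h j); lia. Qed.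

Lemma lift_perm_inj n (i j : 'I_n.+1) : injective (lift_perm i j).
Proof.
move=> s t eq_st; apply/permP=> x; apply: (@lift_inj _ j).
by rewrite -!(lift_perm_lift i) eq_st.
Qed.

(** Every permutation arises by inserting a letter at a given position: the
    insertion map (j, t) |-> [lift_perm i j t] is injective, and its domain
    and codomain have the same cardinality (n + 1)!. *)
Lemma lift_perm_onto n (i : 'I_n.+1) (s : 'S_n.+1) :
  exists t : 'S_n, s = lift_perm i (s i) t.
Proof.
pose F (p : 'I_n.+1 * 'S_n) := lift_perm i p.1 p.2.
have injF : injective F.
  move=> [j t] [j' t'] eqF.
  have eqj : j = j' by have := congr1 (fun s : 'S__ => s i) eqF; rewrite /F !lift_perm_id.
  by move: eqF; rewrite eqj => /lift_perm_inj eq_t; congr (_, _).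
have cardF : #|{: 'S_n.+1}| <= #|{: 'I_n.+1 * 'S_n}|.
  by rewrite card_prod card_ord !card_Sn factS.
have [G _ GK] := inj_card_bij injF cardF.
by exists (G s).2; rewrite -[in LHS](GK s) -[in X in lift_perm _ X _](GK s) /F lift_perm_id.
Qed.

(** * Counting the 132-avoiding permutations *)

(** A 132 that starts with the new letter j is an inversion among the later
    letters that are at least j in t. If the first letter of t is at most j, it
    is not part of such an inversion, being the smallest of these letters or
    smaller still, and it forms a 132 of t with it. If it exceeds j, it forms
    such an inversion with the letter equal to j in t. *)
Lemma avoids132_lift_first n (j : 'I_n.+2) (t : 'S_n.+1) :
  ~~ contains pattern132 (lift_perm ord0 j t)
  = ~~ contains pattern132 t && (t ord0 <= j).
Proof.
apply/avoids132P/andP=> [av | [/avoids132P av le_tj] a b c lt_ab lt_bc].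
  split.
    apply/avoids132P=> a b c lt_ab lt_bc.
    have := av (lift ord0 a) (lift ord0 b) (lift ord0 c).
    by rewrite !lift_perm_lift !ltn_lift => /(_ lt_ab lt_bc).
  rewrite leqNgt; apply/negP=> lt_jt.
  have jn : j < n.+1 by apply: leq_trans lt_jt _; rewrite ltnW.
  (* c is the position in t of the value that the insertion of j turns into j + 1. *)
  pose c := (t^-1)%g (Ordinal jn).
  have tc : t c = Ordinal jn by rewrite permKV.
  have c0 : 0 < c.
    rewrite lt0n; apply: contraTneq lt_jt => c0.
    have -> : ord0 = c by apply: val_inj.
    by rewrite tc ltnn.
  have := av ord0 (lift ord0 ord0) (lift ord0 c) isT.
  rewrite !lift_perm_lift lift_perm_id ltn_lift => /(_ c0).
  by rewrite tc !ltn_lift /= lt_jt andbT /bump leqnn ltnSn.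
case: (unliftP ord0 b) lt_ab lt_bc => [b' ->|-> //].
case: (unliftP ord0 c) => [c' ->|-> //].
case: (unliftP ord0 a) => [a' ->|-> _].
  by rewrite !lift_perm_lift !ltn_lift; apply: av.
rewrite !lift_perm_lift lift_perm_id !ltn_lift => lt_bc.
apply/negP=> /andP[lt_jc lt_cb].
have le_tc : t ord0 <= t c'.
  by apply: leq_trans le_tj _; move: lt_jc; rewrite /= /bump; lia.
have b0 : 0 < b'.
  rewrite lt0n; apply: contraTneq lt_cb => b0.
  have -> : b' = ord0 by apply: val_inj.
  by rewrite -leqNgt.
have ne_tc : t ord0 != t c' :> nat.
  by apply: contraTneq (ltn_trans b0 lt_bc) => /val_inj/perm_inj <-.
by have := av ord0 b' c' b0 lt_bc; lia.
Qed.

(** Bounding the first letter, rather than prescribing it, turns the sum in the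
    recurrence on the size into a two-term recurrence. *)
Definition small_first n (j : nat) : {set 'S_n.+1} :=
  [set s | ~~ contains pattern132 s & s ord0 <= j].

Lemma card_first_eq n (j : 'I_n.+2) :
  #|[set s : 'S_n.+2 | ~~ contains pattern132 s & s ord0 == j]| = #|small_first n j|.
Proof.
rewrite -(card_imset _ (@lift_perm_inj _ ord0 j)).
apply: eq_card => s; rewrite inE; apply/andP/imsetP=> [[av /eqP s0] | [t tj ->]].
  have [t def_s] := lift_perm_onto ord0 s; exists t; last by rewrite -s0.
  by move: av; rewrite inE def_s s0 avoids132_lift_first.
by move: tj; rewrite inE avoids132_lift_first lift_perm_id eqxx.
Qed.

(** The recurrence of the ballot numbers: the permutations whose first letter is
    exactly j + 1 are split off, and lose that letter. *)
Lemma card_small_firstS n j : j < n.+1 ->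
  #|small_first n.+1 j.+1| = #|small_first n.+1 j| + #|small_first n j.+1|.
Proof.
move=> ltjn; rewrite -[in X in _ + #|_ X|]/(nat_of_ord (Ordinal (ltjn : j.+1 < n.+2))).
rewrite -card_first_eq -cardsUI.
rewrite [X in _ = _ + #|pred_of_set X|](_ : _ = set0) ?cards0 ?addn0.
  apply: eq_card => s; rewrite !inE -andb_orr -val_eqE /=; congr andb; lia.
by apply/setP=> s; rewrite !inE -val_eqE /=; case: (~~ _) => //=; lia.
Qed.

Lemma card_small_first0 n : #|small_first n 0| = 1.
Proof.
elim: n => [|n <-].
  apply/eqP/cards1P; exists 1%g; apply/setP=> s; rewrite !inE.
  have -> : s = 1%g by apply/permP=> i; rewrite !ord1.
  rewrite eqxx perm1 andbT; apply/avoids132P=> i j k.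
  by rewrite !ord1.
rewrite -(card_first_eq (ord0 : 'I_n.+2)); apply: eq_card => s.
by rewrite !inE leqn0 -val_eqE.
Qed.

Lemma small_first_full n j : n <= j ->
  small_first n j = [set s | ~~ contains pattern132 s].
Proof.
move=> lenj; apply/setP=> s; rewrite !inE.
by rewrite (leq_trans _ lenj) ?andbT // -ltnS.
Qed.

(** Both sides follow Pascal's rule. The range goes one step beyond the largest
    first letter n: at j = n + 1 the count repeats its value at j = n, which the
    formula matches by the symmetry of the middle binomial coefficients. *)
Lemma card_small_first n j : j <= n.+1 ->
  #|small_first n j| + 'C((n + j).+1, n.+2) = 'C((n + j).+1, n.+1).
Proof.
elim: n j => [|n IHn] j; last elim: j => [|j IHj] lejn.
- case: j => [|[|//]] _; first by rewrite card_small_first0.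
  by rewrite small_first_full // -(small_first_full (leqnn 0)) card_small_first0.
- by rewrite addn0 card_small_first0 binn bin_small.
- rewrite addnS binS [in RHS]binS; have {IHj} := IHj (ltnW lejn).
  have [ltjn | lenj] := ltnP j n.+1.
    have := IHn j.+1 ltjn; rewrite card_small_firstS // addnS -addSn.
    lia.
  have -> : j = n.+1 by lia.
  rewrite !small_first_full //.
  have : 'C((n.+1 + n.+1).+1, n.+1) = 'C((n.+1 + n.+1).+1, n.+2).
    by rewrite -bin_sub; [congr 'C(_, _)|]; lia.
  lia.
Qed.

(** Consecutive binomial coefficients of the central row are in the ratio
    (n + 1) : (n + 2), so n + 2 times their difference is the larger one. *)
Lemma catalan_ballot n : catalan n.+1 + 'C(2 * n.+1, n.+2) = 'C(2 * n.+1, n.+1).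
Proof.
have e : n.+2 * 'C(2 * n.+1, n.+2) = n.+1 * 'C(2 * n.+1, n.+1).
  by rewrite mul_bin_left; congr (_ * _); lia.
have def_C : 'C(2 * n.+1, n.+1) = n.+2 * ('C(2 * n.+1, n.+1) - 'C(2 * n.+1, n.+2)).
  by rewrite mulnBr e; lia.
rewrite /catalan {1}def_C mulKn //.
have : n.+2 * 'C(2 * n.+1, n.+2) <= n.+2 * 'C(2 * n.+1, n.+1).
  by rewrite e leq_mul2r leqnSn orbT.
rewrite leq_mul2l /=; lia.
Qed.

Lemma card_avoids132 n :
  #|[set s : 'S_n | ~~ contains pattern132 s]| = catalan n.
Proof.
case: n => [|n].
  rewrite /catalan /= bin0 divn1; apply/eqP/cards1P; exists 1%g.
  apply/setP=> s; rewrite !inE.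
  have -> : s = 1%g by apply/permP=> -[].
  by rewrite eqxx; apply/avoids132P=> -[].
have := card_small_first (leqnn n.+1).
rewrite small_first_full // (_ : (n + n.+1).+1 = 2 * n.+1); last by lia.
by rewrite -catalan_ballot => /addIn.
Qed.

(** * Occurrences of the shaded pattern in 132-avoiding permutations *)

(** The final letter can only be the last letter of a 132, which is not its
    largest one. *)
Lemma avoids132_lift_last n (t : 'S_n) :
  ~~ contains pattern132 (lift_perm ord_max ord_max t)
  = ~~ contains pattern132 t.
Proof.
apply/avoids132P/avoids132P=> av a b c.
  move=> lt_ab lt_bc.
  have := av (lift ord_max a) (lift ord_max b) (lift ord_max c).
  by rewrite !lift_perm_lift !ltn_lift => /(_ lt_ab lt_bc).
case: (unliftP ord_max c) => [c' ->|-> _ _]; last first.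
  by rewrite lift_perm_id andbC [_ < lift_perm _ _ _ _]ltnNge -[_ <= ord_max]ltnS ltn_ord.
case: (unliftP ord_max b) => [b' ->|->]; last first.
  by move=> _; rewrite lift_max ltnNge ltnW //=.
case: (unliftP ord_max a) => [a' ->|->]; last first.
  by rewrite lift_max ltnNge ltnW //=.
by rewrite !lift_perm_lift !ltn_lift; apply: av.
Qed.

(** Dropping the last point of an occurrence of A_(m+1) leaves an occurrence of
    12...m away from the last letter. Conversely the final maximum extends an
    occurrence of 12...m, and it leaves no room in the shaded cells. *)
Lemma contains_A_lift_last m n (t : 'S_n) :
  contains (pattern_A m.+1) (lift_perm ord_max ord_max t)
  = contains (classical (increasing_perm m)) t.
Proof.
apply/contains_AP/contains_increasingP => [[f [posf valf _ _]] | [f [posf valf]]].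
  have ltf (i : 'I_m) : f (lift ord_max i) < n.
    have : f (lift ord_max i) < f ord_max by apply: posf; rewrite lift_max /=.
    by move=> lti; apply: leq_trans lti _; rewrite -ltnS.
  pose g i := Ordinal (ltf i).
  have gE i : lift ord_max (g i) = f (lift ord_max i).
    by apply: val_inj; rewrite [LHS](lift_max (g i)).
  exists g; split=> i j ltij.
    by rewrite -(ltn_lift ord_max) !gE; apply: posf; rewrite ltn_lift.
  rewrite -(ltn_lift ord_max) -!(lift_perm_lift ord_max) !gE.
  by apply: valf; rewrite ltn_lift.
(* g extends f by the final maximum. *)
pose g (i : 'I_m.+1) := oapp (fun i' => lift ord_max (f i')) ord_max (unlift ord_max i).
have gM : g ord_max = ord_max by rewrite /g unlift_none.
have gL i : g (lift ord_max i) = lift ord_max (f i) by rewrite /g liftK.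
have lt_max k (i j : 'I_k.+1) : i < j -> exists i' : 'I_k, i = lift ord_max i'.
  case: (unliftP ord_max i) => [i' ->|-> /= ltj]; first by exists i'.
  by have := ltn_ord j; lia.
exists g; split.
- move=> i j ltij; have [i' def_i] := lt_max _ _ _ ltij.
  move: ltij; rewrite def_i gL; case: (unliftP ord_max j) => [j' ->|-> _].
    by rewrite gL !ltn_lift; apply: posf.
  by rewrite gM lift_max /=.
- move=> i j ltij; have [i' def_i] := lt_max _ _ _ ltij.
  move: ltij; rewrite def_i gL lift_perm_lift.
  case: (unliftP ord_max j) => [j' ->|-> _].
    by rewrite gL lift_perm_lift !ltn_lift; apply: valf.
  by rewrite gM lift_perm_id lift_max /=.
- by move=> r _; rewrite gM lift_perm_id /= -ltnS.
- by move=> r; rewrite gM /=; have := ltn_ord r; lia.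
Qed.

(** If the maximum came earlier, the first point of the occurrence, the maximum
    and the last letter would form a 132: the shaded cells leave no other order. *)
Lemma contains_A_max_last m n (s : 'S_n.+1) :
  ~~ contains pattern132 s -> contains (pattern_A m.+2) s -> s ord_max = ord_max.
Proof.
move=> /avoids132P av /contains_AP[f [posf valf nw se]].
have lt0M : (ord0 : 'I_m.+2) < (ord_max : 'I_m.+2) by [].
have lt_pos := posf _ _ lt0M; have lt_val := valf _ _ lt0M.
pose p := (s^-1)%g ord_max.
have sp : s p = ord_max by rewrite permKV.
have lt_sp r : r != p -> s r < n.
  rewrite -(inj_eq (@perm_inj _ s)) sp -val_eqE /= => ner.
  by have := ltn_ord (s r); lia.
have le_M : s (f ord_max) <= n by rewrite -ltnS.
have lt0p : f ord0 < p.
  rewrite ltnNge leq_eqVlt negb_or; apply/andP; split.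
    by apply: contraTneq lt_val => /val_inj <-; rewrite sp /= -leqNgt.
  apply: contraTN lt_val => ltp; have := nw p ltp; rewrite sp /= => le_n.
  have : f ord_max != p.
    by apply: contraTneq ltp => <-; rewrite -leqNgt ltnW.
  by move=> /lt_sp; lia.
have [eq_p | nep] := eqVneq ord_max p; first by rewrite [in LHS]eq_p.
have ltpM : p < n by move: nep; rewrite -val_eqE /=; have := ltn_ord p; lia.
have sM := lt_sp _ nep.
(* The last letter is either the end point of the occurrence or, by the bottom
   right cell, above its first point. *)
have /ltnW le0M : s (f ord0) < s ord_max.
  have [eqM | neM] := eqVneq (f ord_max) ord_max; first by rewrite -[in X in _ < X]eqM.
  have ltM : f ord_max < n.
    by move: neM; rewrite -val_eqE /=; have := ltn_ord (f ord_max); lia.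
  have := se ord_max ltM; rewrite leq_eqVlt => /orP[/eqP/val_inj/perm_inj e0|//].
  by move: lt0p; rewrite e0 /=; lia.
have := av (f ord0) p ord_max lt0p ltpM; rewrite sp /= sM andbT -leqNgt => leM0.
have /val_inj/perm_inj e0 : s (f ord0) = s ord_max :> nat by apply/eqP; rewrite eqn_leq le0M.
by move: lt0p; rewrite e0 /=; lia.
Qed.

Lemma card_avoids132_contains_A n m :
  #|[set s : 'S_n.+1 | ~~ contains pattern132 s & contains (pattern_A m.+2) s]|
  = #|[set t : 'S_n | ~~ contains pattern132 t
                    & contains (classical (increasing_perm m.+1)) t]|.
Proof.
rewrite -(card_imset _ (@lift_perm_inj n ord_max ord_max)).
apply: eq_card => s; rewrite inE; apply/andP/imsetP=> [[av hasA] | [t]].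
  have sM := contains_A_max_last av hasA.
  have [t def_s] := lift_perm_onto ord_max s; rewrite sM in def_s.
  by exists t; rewrite // inE -avoids132_lift_last -contains_A_lift_last -def_s av.
by rewrite inE -avoids132_lift_last -contains_A_lift_last => /andP[av hasA] ->.
Qed.

Lemma card_avoidersD n q :
  #|avoiders n pattern132 q|
  + #|[set s : 'S_n | ~~ contains pattern132 s & contains q s]| = catalan n.
Proof.
rewrite -card_avoids132 addnC -[RHS](cardsID [set s | contains q s]).
by congr (_ + _); apply: eq_card => s; rewrite !inE // andbC.
Qed.

Theorem theorem4p2 (n k : nat) (hn : (1 <= n)%N) (hk : (3 <= k)%N) :
  (#|avoiders n pattern132 (pattern_A k)|%:Z
   = (catalan n)%:Z - (catalan n.-1)%:Z
     + #|avoiders n.-1 pattern132 (classical (increasing_perm k.-1))|%:Z)%R.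
Proof.
case: n hn => [//|n] _; case: k hk => [|[|m]] //= _.
have := card_avoidersD n.+1 (pattern_A m.+2).
have := card_avoidersD n (classical (increasing_perm m.+1)).
rewrite card_avoids132_contains_A => <- <-; rewrite !PoszD; ring.
Qed.
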